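(* For any constants $\lambda_{ij}\ge 0$ ($i,j=1,\dots,k$, $i\neq j$) and for any sequential testing procedure $(\chi,\psi,\phi)$, $$L(\chi,\psi,\phi)\ \ge\ N(\chi,\psi)+\sum_{n=1}^\infty\int (1-\psi_1^\chi)\cdots(1-\psi_{n-1}^\chi)\,\psi_n^\chi\, l_n^\chi\, d\mu^n ,$$ where $$L(\chi,\psi,\phi)=N(\chi,\psi)+\sum_{1\le i,j\le k,\ i\ne j}\lambda_{ij}\,\alpha_{ij}(\chi,\psi,\phi),\qquad l_n=\min_{1\le j\le k}\ \sum_{i\neq j}\lambda_{ij}f_{\theta_i}^n .$$ The right-hand side of the inequality is attained (i.e. equality holds) if $$\phi_{nj}\le I_{\left\{\sum_{i\ne j}\lambda_{ij}f_{\theta_i}^n=l_n\right\}}\quad\text{for any } n=1,2,\dots\text{ and any } j=1,\dots,k .$$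
   Context: Model. There are $k\ge 2$ simple hypotheses $H_i:\theta=\theta_i$, $i=1,\dots,k$. A control variable takes values in a measurable space $\mathcal X$; observations take values in a measurable space $\mathcal Y$ with a $\sigma$-finite measure $\mu$. Under parameter $\theta$ and control $x$, an observation has density $f_\theta(y|x)$ with respect to $\mu$. Given controls $x_1,\dots,x_n$, the observations are independent, with joint density $f_\theta^n=f_\theta^n(x^{(n)},y^{(n)})=\prod_{i=1}^n f_\theta(y_i|x_i)$ with respect to the product measure $\mu^n=\mu\otimes\cdots\otimes\mu$. Here $x^{(n)}=(x_1,\dots,x_n)$, $y^{(n)}=(y_1,\dots,y_n)$. Procedures. A sequential testing procedure is a triplet $(\chi,\psi,\phi)$: a control policy $\chi=(\chi_1,\chi_2,\dots)$ of measurable functions $\chi_n=\chi_n(x^{(n-1)},y^{(n-1)})$ with values in $\mathcal X$ ($\chi_1$ is a fixed element of $\mathcal X$); a stopping rule $\psi=(\psi_1,\psi_2,\dots)$ of measurable functions $\psi_n=\psi_n(x^{(n)},y^{(n)})\in[0,1]$ (conditional probability of stopping at stage $n$ given that stage $n$ is reached); and a decision rule $\phi=(\phi_1,\phi_2,\dots)$, $\phi_n=(\phi_{n1},\dots,\phi_{nk})$, of measurable functions $\phi_{nj}=\phi_{nj}(x^{(n)},y^{(n)})\ge0$ with $\sum_{j=1}^k\phi_{nj}\equiv1$ ($\phi_{nj}$ is the conditional probability of accepting $H_j$ when stopping at stage $n$). At each stage the control $x_n=\chi_n(x^{(n-1)},y^{(n-1)})$ is applied and then $y_n$ is observed. Notation.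 For a function $F_n=F_n(x^{(n)},y^{(n)})$, $F_n^\chi(y^{(n)})$ denotes $F_n(x^{(n)},y^{(n)})$ with $x_1,\dots,x_n$ determined recursively by $x_i=\chi_i(x^{(i-1)},y^{(i-1)})$; in particular $f_\theta^{n,\chi}$ is the density of $Y^{(n)}$ under $\theta$ and policy $\chi$, so $E_\theta^\chi g(Y^{(n)})=\int g f_\theta^{n,\chi}d\mu^n$, and $E_\theta^\chi F_n=\int F_n^\chi f_\theta^{n,\chi}d\mu^n$. $I_A$ is the indicator of $A$. The stopping time $\tau_\psi$ satisfies $P_\theta^\chi(\tau_\psi=n)=E_\theta^\chi(1-\psi_1)\cdots(1-\psi_{n-1})\psi_n$. Error probabilities: $\alpha_{ij}(\chi,\psi,\phi)=\sum_{n=1}^\infty E_{\theta_i}^\chi(1-\psi_1)\cdots(1-\psi_{n-1})\psi_n\phi_{nj}$. Average sample number: $N(\chi,\psi)=E_{\theta_1}^\chi\tau_\psi=\sum_{n\ge1} nP_{\theta_1}^\chi(\tau_\psi=n)$ if $P_{\theta_1}^\chi(\tau_\psi<\infty)=1$, and $N(\chi,\psi)=\infty$ otherwise. *)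

(* Defs.v *)
From HB Require Import structures.
From mathcomp Require Import all_boot all_order all_algebra.
From mathcomp Require Import all_classical all_reals all_analysis.

Set Implicit Arguments.
Unset Strict Implicit.
Unset Printing Implicit Defensive.

Import Order.TTheory GRing.Theory Num.Theory.
Import numFieldNormedType.Exports.

Local Open Scope classical_set_scope.
Local Open Scope ring_scope.
Local Open Scope ereal_scope.

Lemma ord_widenVmax n (i : 'I_n.+1) :
  (exists j, i = widen_ord (leqnSn n) j) \/ i = ord_max.
Proof.
have [ltin|lein] := ltnP i n; [left|right].
  by exists (Ordinal ltin); apply/val_inj.
by apply/val_inj/eqP; rewrite /= eqn_leq lein -ltnS ltn_ord.
Qed.

Section tuples.
Context {T : Type}.

(* [prefix le_mn t] is $t^{(m)}=(t_1,\dots,t_m)$ for $t=t^{(n)}$, $m\le n$. *)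
Definition prefix (m n : nat) (le_mn : (m <= n)%N) (t : n.-tuple T) :
  m.-tuple T := [tuple tnth t (widen_ord le_mn i) | i < m].

Definition snoc (n : nat) (p : n.-tuple T * T) : n.+1.-tuple T :=
  [tuple of rcons p.1 p.2].

Lemma tnth_snoc_widen n (p : n.-tuple T * T) (i : 'I_n) :
  tnth (snoc p) (widen_ord (leqnSn n) i) = tnth p.1 i.
Proof. by rewrite !(tnth_nth p.2)/= nth_rcons size_tuple ltn_ord. Qed.

Lemma tnth_snoc_max n (p : n.-tuple T * T) : tnth (snoc p) ord_max = p.2.
Proof. by rewrite (tnth_nth p.2)/= nth_rcons size_tuple ltnn eqxx. Qed.

End tuples.

Section product_measure.
Context d (Y : measurableType d) (R : realType).

Lemma measurable_snoc n :
  measurable_fun [set: (n.-tuple Y * Y)%type] (@snoc Y n).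
Proof.
apply/measurable_fun_tnthP => i.
have [[j ->]|->] := ord_widenVmax i.
- rewrite (_ : _ \o _ = (fun t : n.-tuple Y => tnth t j) \o fst); last first.
    by apply/funext => p /=; rewrite tnth_snoc_widen.
  by apply: measurableT_comp => //; exact: measurable_tnth.
- rewrite (_ : _ \o _ = snd) //.
  by apply/funext => p /=; rewrite tnth_snoc_max.
Qed.

Section snoc_measure.
Variables (n : nat) (m : {measure set (n.-tuple Y) -> \bar R}).
Variable mu : {sigma_finite_measure set Y -> \bar R}.

Definition snoc_measure : set (n.+1.-tuple Y) -> \bar R :=
  pushforward (m \x mu) (@snoc Y n).

Let snoc_measure0 : snoc_measure set0 = 0.
Proof. by rewrite /snoc_measure /pushforward preimage_set0 measure0. Qed.

Let snoc_measure_ge0 A : 0 <= snoc_measure A.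
Proof. by rewrite /snoc_measure /pushforward. Qed.

Let snoc_measure_sigma_additive : semi_sigma_additive snoc_measure.
Proof.
rewrite /snoc_measure; apply: measure_semi_sigma_additive.
exact: measurable_snoc.
Qed.

HB.instance Definition _ := isMeasure.Build _ _ _ snoc_measure
  snoc_measure0 snoc_measure_ge0 snoc_measure_sigma_additive.

End snoc_measure.

Fixpoint measure_pow (mu : {sigma_finite_measure set Y -> \bar R}) (n : nat) :
    {measure set (n.-tuple Y) -> \bar R} :=
  match n with
  | 0%N => \d_([tuple] : 0.-tuple Y)
  | n'.+1 => snoc_measure (measure_pow mu n') mu
  end.

Lemma measure_pow_box (mu : {sigma_finite_measure set Y -> \bar R}) (n : nat)
    (A : 'I_n -> set Y) : (forall i, measurable (A i)) ->
  measure_pow mu n [set y | forall i, A i (tnth y i)] = \prod_(i < n) mu (A i).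
Proof.
elim: n A => [|n IH] A mA.
  by rewrite big_ord0 /= diracE mem_set//= => -[].
rewrite big_ord_recr/=.
pose B := [set y : n.-tuple Y |
  forall i, A (widen_ord (leqnSn n) i) (tnth y i)].
have mB : measurable B.
  rewrite (_ : B = \bigcap_(i in [set: 'I_n])
      ((fun y => tnth y i) @^-1` A (widen_ord (leqnSn n) i))); last first.
    by apply/seteqP; split => [y By i _|y By i]; [exact: By|exact: By].
  apply: fin_bigcap_measurable => // i _.
  by rewrite -[X in measurable X]setTI; exact: measurable_tnth.
rewrite -(IH (fun i => A (widen_ord (leqnSn n) i)))//.
rewrite -(@product_measure1E _ _ _ _ _ (measure_pow mu n) mu B)//.
rewrite /snoc_measure /pushforward; congr (product_measure1 _ _ _).
apply/seteqP; split => -[y z] /= => [yzA|[By Az] i].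
  split=> [i|].
    by have := yzA (widen_ord (leqnSn n) i); rewrite tnth_snoc_widen.
  by have := yzA ord_max; rewrite tnth_snoc_max.
have [[j ->]|->] := ord_widenVmax i.
- by rewrite tnth_snoc_widen.
- by rewrite tnth_snoc_max.
Qed.

End product_measure.

Section procedures.
Context dX dY (X : measurableType dX) (Y : measurableType dY) (R : realType).

(* [chi n x y] is $\chi_{n+1}(x^{(n)},y^{(n)})$, the control applied after $n$
   observations; for [n = 0] both tuples are empty. *)
Record control_policy := ControlPolicy {
  policy_fun :> forall n, n.-tuple X -> n.-tuple Y -> X;
  measurable_policy : forall n, measurable_fun setT
    (fun z : n.-tuple X * n.-tuple Y => policy_fun z.1 z.2) }.

(* [psi n] is $\psi_n$ for $n\ge1$; [psi 0] is never used. *)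
Record stopping_rule := StoppingRule {
  stop_fun :> forall n, n.-tuple X -> n.-tuple Y -> R;
  measurable_stop : forall n, (0 < n)%N -> measurable_fun setT
    (fun z : n.-tuple X * n.-tuple Y => stop_fun z.1 z.2);
  stop_itv : forall n (x : n.-tuple X) (y : n.-tuple Y), (0 < n)%N ->
    (0 <= stop_fun x y <= 1)%R }.

(* [phi n j] is $\phi_{nj}$ for $n\ge1$; [phi 0] is never used. *)
Record decision_rule (k : nat) := DecisionRule {
  decide_fun :> forall n, 'I_k -> n.-tuple X -> n.-tuple Y -> R;
  measurable_decide : forall n (j : 'I_k), (0 < n)%N -> measurable_fun setT
    (fun z : n.-tuple X * n.-tuple Y => decide_fun j z.1 z.2);
  decide_ge0 : forall n j (x : n.-tuple X) (y : n.-tuple Y), (0 < n)%N ->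
    (0 <= decide_fun j x y)%R;
  decide_sum1 : forall n (x : n.-tuple X) (y : n.-tuple Y), (0 < n)%N ->
    (\sum_(j < k) decide_fun j x y = 1)%R }.

Fixpoint controls (chi : control_policy) (n : nat) :
    n.-tuple Y -> n.-tuple X :=
  match n with
  | 0%N => fun=> [tuple]
  | n'.+1 => fun y =>
      let y' := prefix (leqnSn n') y in
      let x' := controls chi y' in
      snoc (x', chi n' x' y')
  end.

(* $F^\chi(y^{(n)})$ *)
Definition under (chi : control_policy) (V : Type) (n : nat)
    (F : n.-tuple X -> n.-tuple Y -> V) (y : n.-tuple Y) : V :=
  F (controls chi y) y.

(* $(1-\psi_1)\cdots(1-\psi_{n-1})\psi_n$ *)
Definition stop_at (psi : stopping_rule) (n : nat)
    (x : n.-tuple X) (y : n.-tuple Y) : R :=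
  ((\prod_(i < n | (0 < i)%N)
     (1 - psi i (prefix (ltnW (ltn_ord i)) x) (prefix (ltnW (ltn_ord i)) y)))
   * psi n x y)%R.

Definition joint_density (g : X -> Y -> R) (n : nat)
    (x : n.-tuple X) (y : n.-tuple Y) : R :=
  (\prod_(i < n) g (tnth x i) (tnth y i))%R.

Variable mu : {sigma_finite_measure set Y -> \bar R}.

(* In the next four definitions [g] is the density $f_\theta$ of the parameter
   under which expectations are taken. *)
Definition expect (g : X -> Y -> R) (chi : control_policy) (n : nat)
    (F : n.-tuple X -> n.-tuple Y -> R) : \bar R :=
  \int[measure_pow mu n]_y
    (under chi F y * under chi (joint_density g (n:=n)) y)%:E.

Definition prob_stop_at (g : X -> Y -> R) (chi : control_policy)
    (psi : stopping_rule) (n : nat) : \bar R :=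
  expect g chi (stop_at psi (n:=n)).

Definition prob_stop (g : X -> Y -> R) (chi : control_policy)
    (psi : stopping_rule) : \bar R :=
  \sum_(1 <= n <oo) prob_stop_at g chi psi n.

Definition sample_number (g : X -> Y -> R) (chi : control_policy)
    (psi : stopping_rule) : \bar R :=
  if prob_stop g chi psi == 1
  then \sum_(1 <= n <oo) n%:R%:E * prob_stop_at g chi psi n
  else +oo.

Variables (k : nat) (f : 'I_k -> X -> Y -> R).

Definition error_prob (chi : control_policy) (psi : stopping_rule)
    (phi : decision_rule k) (i j : 'I_k) : \bar R :=
  \sum_(1 <= n <oo)
    expect (f i) chi (fun x y => stop_at psi x y * phi n j x y)%R.

Variable lambda : 'I_k -> 'I_k -> R.

(* [i1] is the index of the hypothesis under which $N$ is computed. *)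
Definition lagrangian (i1 : 'I_k) (chi : control_policy)
    (psi : stopping_rule) (phi : decision_rule k) : \bar R :=
  sample_number (f i1) chi psi +
  \sum_(i < k) \sum_(j < k | i != j)
    (lambda i j)%:E * error_prob chi psi phi i j.

Definition wrong_weight (n : nat) (j : 'I_k)
    (x : n.-tuple X) (y : n.-tuple Y) : R :=
  (\sum_(i < k | i != j) lambda i j * joint_density (f i) x y)%R.

(* $l_n$; extended-real valued only so that [+oo] can be the neutral element of
   the minimum: the value is finite as soon as $k\ge1$. *)
Definition min_weight (n : nat) (x : n.-tuple X) (y : n.-tuple Y) : \bar R :=
  \big[Order.min/+oo]_(j < k) (wrong_weight j x y)%:E.

End procedures.

(* Main.v *)
(* Summing by stages, the error part of the Lagrangian is the sum over $n$ of the
   integrals of $(1-\psi_1)\cdots(1-\psi_{n-1})\psi_n$ times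
   $\sum_j\phi_{nj}\sum_{i\ne j}\lambda_{ij}f_{\theta_i}^n$ (Tonelli). The last
   factor is an average of $k$ numbers whose minimum is $l_n$; it equals $l_n$
   as soon as the average only charges minimisers. *)
Require Import Defs.
From HB Require Import structures.
From mathcomp Require Import all_boot all_order all_algebra.
From mathcomp Require Import all_classical all_reals all_analysis.
From mathcomp Require Import measurable_realfun.

Set Implicit Arguments.
Unset Strict Implicit.
Unset Printing Implicit Defensive.

Import Order.TTheory GRing.Theory Num.Theory.
Import numFieldNormedType.Exports.

Local Open Scope classical_set_scope.
Local Open Scope ring_scope.
Local Open Scope ereal_scope.

(* The library versions of the next four lemmas constrain all terms of a series
   rather than those from rank [N] on; here the term of rank 0 is arbitrary,
   because [psi 0] and [phi 0] are. *)
Lemma eq_eseriesr_from (R : realFieldType) (u v : (\bar R)^nat) N :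
  (forall n, (N <= n)%N -> u n = v n) ->
  \sum_(N <= n <oo) u n = \sum_(N <= n <oo) v n.
Proof.
by move=> uv; rewrite eseries_cond [RHS]eseries_cond; exact: eq_eseriesr.
Qed.

Lemma nneseriesZl_from (R : realType) (u : (\bar R)^nat) (c : R) N :
  (forall n, (N <= n)%N -> 0 <= u n) ->
  \sum_(N <= n <oo) c%:E * u n = c%:E * \sum_(N <= n <oo) u n.
Proof.
by move=> u0; rewrite eseries_cond [in RHS]eseries_cond; exact: nneseriesZl.
Qed.

Lemma nneseries_sum_from (R : realType) (I : Type) (r : seq I)
    (u : I -> (\bar R)^nat) N :
  (forall i n, (N <= n)%N -> 0 <= u i n) ->
  \sum_(N <= n <oo) \sum_(i <- r) u i n = \sum_(i <- r) \sum_(N <= n <oo) u i n.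
Proof.
(* Cutting [u] off to 0 below rank [N] makes every term nonnegative and leaves the series from [N]
   on unchanged. *)
move=> u0; pose v i n := if (N <= n)%N then u i n else 0.
have vE i n : (N <= n)%N -> u i n = v i n by rewrite /v => ->.
under eq_bigr do rewrite (eq_eseriesr_from (vE _)).
rewrite -nneseries_sum; last by move=> i n _; rewrite /v; case: ifPn => // /u0.
by apply: eq_eseriesr_from => n Nn; apply: eq_bigr => i _; exact: vE.
Qed.

Lemma le_nneseries_from (R : realType) (u v : (\bar R)^nat) N :
  (forall n, (N <= n)%N -> 0 <= u n <= v n) ->
  \sum_(N <= n <oo) u n <= \sum_(N <= n <oo) v n.
Proof.
move=> uv; rewrite eseries_cond [leRHS]eseries_cond.
by apply: lee_nneseries => n; [move=> _|]; move=> /uv /andP[].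
Qed.

Lemma ge0_integral_wsum d (T : measurableType d) (R : realType)
    (m : {measure set T -> \bar R}) (I : Type) (r : seq I) (c : I -> R)
    (g : I -> T -> R) :
  (forall i, 0 <= c i)%R -> (forall i, measurable_fun setT (g i)) ->
  (forall i x, 0 <= g i x)%R ->
  \sum_(i <- r) (c i)%:E * \int[m]_x (g i x)%:E =
  \int[m]_x (\sum_(i <- r) c i * g i x)%R%:E.
Proof.
move=> c0 mg g0; under [RHS]eq_integral do rewrite -sumEFin.
rewrite ge0_integral_sum//; first last.
- by move=> i x _; rewrite lee_fin mulr_ge0.
- move=> i; apply/measurable_EFinP; apply: measurable_funM => //.
apply: eq_bigr => i _; under [RHS]eq_integral do rewrite EFinM.
rewrite ge0_integralZl_EFin//; first by move=> x _; rewrite lee_fin.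
exact/measurable_EFinP.
Qed.

(** Policies, rules and densities are curried but measurable jointly; this is how they are composed
    with measurable functions of the observations. *)
Lemma measurable_fun_uncurry_comp d d1 d2 d3 (T : measurableType d)
    (T1 : measurableType d1) (T2 : measurableType d2) (T3 : measurableType d3)
    (F : T1 -> T2 -> T3) (u : T -> T1) (v : T -> T2) :
  measurable_fun setT (fun z : T1 * T2 => F z.1 z.2) ->
  measurable_fun setT u -> measurable_fun setT v ->
  measurable_fun setT (fun x => F (u x) (v x)).
Proof.
by move=> mF u_meas v_meas;
  exact: (measurableT_comp mF (measurable_fun_pair u_meas v_meas)).
Qed.

Lemma measurable_fun_prefix d (T : measurableType d) m n (le_mn : (m <= n)%N) :
  measurable_fun setT (Defs.prefix le_mn : n.-tuple T -> m.-tuple T).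
Proof.
apply/measurable_fun_tnthP => i.
rewrite (_ : _ \o _ = fun t => tnth t (widen_ord le_mn i)).
  exact: measurable_tnth.
by apply/funext => t /=; rewrite tnth_mktuple.
Qed.

(** * Measurability along a control policy *)

Section procedures.
Context dX dY (X : measurableType dX) (Y : measurableType dY) (R : realType).
Variables (chi : control_policy X Y) (psi : stopping_rule X Y R).

Lemma measurable_controls n : measurable_fun setT (@controls _ _ _ _ chi n).
Proof.
elim: n => [|n IH] /=; first exact: measurable_cst.
apply: (measurableT_comp (@measurable_snoc _ X n)).
have mp := @measurable_fun_prefix _ Y _ _ (leqnSn n).
apply: measurable_fun_pair; first exact: measurableT_comp mp.
apply: (measurable_fun_uncurry_comp (@measurable_policy _ _ _ _ chi n)) => //.
exact: measurableT_comp mp.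
Qed.

Lemma measurable_under d (V : measurableType d) n
    (F : n.-tuple X -> n.-tuple Y -> V) :
  measurable_fun setT (fun z : n.-tuple X * n.-tuple Y => F z.1 z.2) ->
  measurable_fun setT (under chi F).
Proof.
move=> mF; apply: (measurable_fun_uncurry_comp mF) => //.
exact: measurable_controls.
Qed.

Lemma measurable_stop_at n : (0 < n)%N ->
  measurable_fun setT
    (fun z : n.-tuple X * n.-tuple Y => stop_at psi z.1 z.2).
Proof.
move=> n0; apply: measurable_funM; last exact: measurable_stop.
(* Turning the guard [0 < i] into a factor 1 removes [psi 0], about which nothing is assumed. *)
under eq_fun do rewrite big_mkcond.
apply: measurable_prod => i _; case: ltnP => i0; last exact: measurable_cst.
apply: measurable_funB => //.
apply: (measurable_fun_uncurry_comp (measurable_stop psi i0));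
  by apply: measurableT_comp => //; exact: measurable_fun_prefix.
Qed.

Lemma stop_at_ge0 n (x : n.-tuple X) (y : n.-tuple Y) : (0 < n)%N ->
  (0 <= stop_at psi x y)%R.
Proof.
move=> n0; apply: mulr_ge0; last by case/andP: (stop_itv psi x y n0).
by apply: prodr_ge0 => i i0; rewrite subr_ge0; case/andP: (stop_itv psi
  (Defs.prefix (ltnW (ltn_ord i)) x) (Defs.prefix (ltnW (ltn_ord i)) y) i0).
Qed.

Lemma measurable_joint_density (g : X -> Y -> R) n :
  measurable_fun setT (fun z : X * Y => g z.1 z.2) ->
  measurable_fun setT
    (fun z : n.-tuple X * n.-tuple Y => joint_density g z.1 z.2).
Proof.
move=> mg; apply: measurable_prod => i _; 
apply: (measurable_fun_uncurry_comp mg);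
  exact: (measurableT_comp (measurable_tnth i)).
Qed.

(** * Weights of wrong decisions and their minimum *)

Variables (k : nat) (f : 'I_k -> X -> Y -> R) (lambda : 'I_k -> 'I_k -> R).
Hypothesis f_meas :
  forall i, measurable_fun setT (fun z : X * Y => f i z.1 z.2).
Hypothesis f_ge0 : forall i x y, (0 <= f i x y)%R.
Hypothesis lambda_ge0 : forall i j, i != j -> (0 <= lambda i j)%R.

Lemma joint_density_ge0 n i (x : n.-tuple X) (y : n.-tuple Y) :
  (0 <= joint_density (f i) x y)%R.
Proof. exact: prodr_ge0. Qed.

Lemma wrong_weight_ge0 n j (x : n.-tuple X) (y : n.-tuple Y) :
  (0 <= wrong_weight f lambda j x y)%R.
Proof.
apply: sumr_ge0 => i ij.
by rewrite mulr_ge0 ?lambda_ge0 ?joint_density_ge0.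
Qed.

Lemma measurable_wrong_weight n j :
  measurable_fun setT
    (fun z : n.-tuple X * n.-tuple Y => wrong_weight f lambda j z.1 z.2).
Proof.
under eq_fun do rewrite /wrong_weight big_mkcond.
apply: measurable_sum => i; case: (i != j); last exact: measurable_cst.
by apply: measurable_funM => //; exact: measurable_joint_density.
Qed.

Lemma measurable_min_weight n :
  measurable_fun setT
    (fun z : n.-tuple X * n.-tuple Y => min_weight f lambda z.1 z.2).
Proof.
(* Induction on the list of hypotheses; the minimum over the empty list is the constant [+oo]. *)
rewrite /min_weight; elim: (index_enum _) => [|j r IH].
  by under eq_fun do rewrite big_nil; exact: measurable_cst.
under eq_fun do rewrite big_cons.
apply: measurable_mine => //.
by apply/measurable_EFinP; exact: measurable_wrong_weight.
Qed.

Lemma min_weight_ge0 n (x : n.-tuple X) (y : n.-tuple Y) :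
  0 <= min_weight f lambda x y.
Proof.
by apply: le_bigmin => [|j _]; rewrite ?leey// lee_fin wrong_weight_ge0.
Qed.

Lemma min_weight_le n j (x : n.-tuple X) (y : n.-tuple Y) :
  min_weight f lambda x y <= (wrong_weight f lambda j x y)%:E.
Proof. exact: bigmin_le. Qed.

(** One hypothesis suffices to bound the minimum by a real weight. The neutral element [+oo] then
    disappears, and convexity arguments can be made in [R]. *)
Lemma min_weight_fineK n (x : n.-tuple X) (y : n.-tuple Y) : (0 < k)%N ->
  (fine (min_weight f lambda x y))%:E = min_weight f lambda x y.
Proof.
move=> k0; rewrite fineK// ge0_fin_numE ?min_weight_ge0//.
exact: le_lt_trans (min_weight_le (Ordinal k0) _ _) (ltry _).
Qed.

(** * Averaged weights and the cost of errors *)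

Variable mu : {sigma_finite_measure set Y -> \bar R}.
Variable (phi : decision_rule X Y R k).

(** With $\lambda_{ij}$ read as prior weight times loss, this is the unnormalised posterior expected
    loss of the randomised decision at stage $n$. *)
Definition decided_weight n (x : n.-tuple X) (y : n.-tuple Y) : R :=
  (\sum_(j < k) phi n j x y * wrong_weight f lambda j x y)%R.

Lemma measurable_decided_weight n : (0 < n)%N ->
  measurable_fun setT
    (fun z : n.-tuple X * n.-tuple Y => decided_weight z.1 z.2).
Proof.
move=> n0; apply: measurable_sum => j; apply: measurable_funM.
  exact: measurable_decide.
exact: measurable_wrong_weight.
Qed.

Lemma min_weight_le_decided n (x : n.-tuple X) (y : n.-tuple Y) :
  (0 < k)%N -> (0 < n)%N ->
  min_weight f lambda x y <= (decided_weight x y)%:E.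
Proof.
move=> k0 n0; rewrite -min_weight_fineK// lee_fin.
(* Writing $l_n=\sum_j\phi_{nj}l_n$ reduces the bound to a comparison term by term. *)
rewrite -[leLHS]mul1r -(decide_sum1 phi x y n0) mulr_suml.
apply: ler_sum => j _; apply: ler_wpM2l; first exact: decide_ge0.
by rewrite -lee_fin min_weight_fineK// min_weight_le.
Qed.

Lemma min_weight_eq_decided n (x : n.-tuple X) (y : n.-tuple Y) :
  (0 < k)%N -> (0 < n)%N ->
  (forall j, (phi n j x y <= \1_[set z : n.-tuple X * n.-tuple Y |
     (wrong_weight f lambda j z.1 z.2)%:E =
     min_weight f lambda z.1 z.2] (x, y))%R) ->
  min_weight f lambda x y = (decided_weight x y)%:E.
Proof.
move=> k0 n0 phi_le; rewrite -min_weight_fineK//; congr EFin.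
rewrite -[LHS]mul1r -(decide_sum1 phi x y n0) mulr_suml.
apply: eq_bigr => j _; have [Wj|Wj] := eqVneq
  (wrong_weight f lambda j x y)%:E (min_weight f lambda x y).
  by rewrite -Wj.
(* If $j$ is not a minimiser, the indicator vanishes, which forces $\phi_{nj}=0$. *)
suff -> : phi n j x y = 0%R by rewrite !mul0r.
apply/eqP; rewrite eq_le decide_ge0// andbT (le_trans (phi_le j))//.
by rewrite indicE memNset//=; exact/eqP.
Qed.

(** Every term is nonnegative, so the finite sum over $(i,j)$ passes through the series and the
    integrals with no convergence condition; both sides may be [+oo]. *)
Lemma error_cost_series :
  \sum_(i < k) \sum_(j < k | i != j)
    (lambda i j)%:E * error_prob mu f chi psi phi i j =
  \sum_(1 <= n <oo) \int[measure_pow mu n]_y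
    (under chi (stop_at psi (n:=n)) y *
     under chi (decided_weight (n:=n)) y)%:E.
Proof.
(* The diagonal of [lambda] is unconstrained. Replacing it by 0 gives nonnegative coefficients on
   all pairs. *)
pose c (p : 'I_k * 'I_k) : R := if p.1 != p.2 then lambda p.1 p.2 else 0%R.
have c0 p : (0 <= c p)%R by rewrite /c; case: ifP => // /lambda_ge0.
pose g (p : 'I_k * 'I_k) n (y : n.-tuple Y) : R :=
  (under chi (fun x y => stop_at psi x y * phi n p.2 x y) y *
   under chi (joint_density (f p.1) (n:=n)) y)%R.
have g0 p n y : (0 < n)%N -> (0 <= g p n y)%R.
  move=> n0; apply: mulr_ge0; last exact: joint_density_ge0.
  by apply: mulr_ge0; [exact: stop_at_ge0|exact: decide_ge0].
have mg p n : (0 < n)%N -> measurable_fun setT (g p n).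
  move=> n0; apply: measurable_funM; apply: measurable_under; last first.
    exact: measurable_joint_density.
  apply: measurable_funM; first exact: measurable_stop_at.
  exact: measurable_decide.
(* The diagonal pairs added here contribute nothing, even if their series diverge, since 0 times
   [+oo] is 0. *)
transitivity (\sum_p (c p)%:E *
    \sum_(1 <= n <oo) \int[measure_pow mu n]_y (g p n y)%:E).
  rewrite -(pair_bigA _ (fun i j => (c (i, j))%:E *
    \sum_(1 <= n <oo) \int[measure_pow mu n]_y (g (i, j) n y)%:E))/=.
  apply: eq_bigr => i _; rewrite big_mkcond; apply: eq_bigr => j _.
  by rewrite /c/=; case: ifP => // _; rewrite mul0e.
under eq_bigr => p _.
  rewrite -nneseriesZl_from; last first.
    by move=> n n0; apply: integral_ge0 => y _; rewrite lee_fin g0.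
  over.
rewrite -nneseries_sum_from; last first.
  move=> p n n0; apply: mule_ge0; first by rewrite lee_fin.
  by apply: integral_ge0 => y _; rewrite lee_fin g0.
apply: eq_eseriesr_from => n n0; rewrite ge0_integral_wsum//; first last.
- by move=> p y; exact: g0.
- by move=> p; exact: mg.
apply: eq_integral => y _; congr EFin.
(* With the accepted hypothesis $j$ outermost, $\phi_{nj}$ is common to the inner sum over $i$,
   which becomes [wrong_weight]. *)
rewrite -(pair_bigA _ (fun i j => c (i, j) * g (i, j) n y)%R)/= exchange_big/=.
rewrite /under /decided_weight mulr_sumr; apply: eq_bigr => j _.
rewrite /wrong_weight !mulr_sumr [RHS]big_mkcond; apply: eq_bigr => i _.
rewrite /c/= /g /under; case: ifP => _; last by rewrite mul0r.
by rewrite mulrCA -mulrA.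
Qed.

End procedures.

(** * The lower bound and its attainment *)

Theorem theorem3 (R : realType) (dX dY : measure_display)
  (X : measurableType dX) (Y : measurableType dY)
  (mu : {sigma_finite_measure set Y -> \bar R})
  (Theta : Type) (f : Theta -> X -> Y -> R)
  (f_meas : forall th, measurable_fun setT (fun z : X * Y => f th z.1 z.2))
  (f_ge0 : forall th x y, (0 <= f th x y)%R)
  (f_int1 : forall th x, \int[mu]_y (f th x y)%:E = 1)
  (k : nat) (k_ge2 : (2 <= k)%N) (theta : 'I_k -> Theta)
  (lambda : 'I_k -> 'I_k -> R)
  (lambda_ge0 : forall i j, i != j -> (0 <= lambda i j)%R)
  (chi : control_policy X Y) (psi : stopping_rule X Y R)
  (phi : decision_rule X Y R k) :
  let i1 : 'I_k := Ordinal (ltnW k_ge2) in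
  let fk : 'I_k -> X -> Y -> R := fun i => f (theta i) in
  let L := lagrangian mu fk lambda i1 chi psi phi in
  let bound := sample_number mu (fk i1) chi psi +
    \sum_(1 <= n <oo) \int[measure_pow mu n]_y
      ((under chi (stop_at psi (n:=n)) y)%:E *
       under chi (min_weight fk lambda (n:=n)) y) in
  bound <= L /\
  ((forall (n : nat) (j : 'I_k) (x : n.-tuple X) (y : n.-tuple Y), (0 < n)%N ->
      (phi n j x y <= \1_[set z : n.-tuple X * n.-tuple Y |
         (wrong_weight fk lambda j z.1 z.2)%:E =
         min_weight fk lambda z.1 z.2] (x, y))%R) ->
   L = bound).
Proof.
move=> i1 fk L bound.
have k0 : (0 < k)%N := ltnW k_ge2.
have fk_meas i : measurable_fun setT (fun z : X * Y => fk i z.1 z.2).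
  exact: f_meas.
have fk_ge0 i x y : (0 <= fk i x y)%R by exact: f_ge0.
(* Both sides now have the form $N$ plus a series over stages, with $l_n$ on one side and its
   $\phi_n$-average on the other. *)
have -> : L = sample_number mu (fk i1) chi psi +
    \sum_(1 <= n <oo) \int[measure_pow mu n]_y
      (under chi (stop_at psi (n:=n)) y *
       under chi (decided_weight fk lambda phi (n:=n)) y)%:E.
  by rewrite -error_cost_series.
split; last first.
  move=> phi_le; congr (_ + _); apply: eq_eseriesr_from => n n0.
  apply: eq_integral => y _; rewrite EFinM; congr (_ * _).
  by rewrite /under (min_weight_eq_decided fk_ge0 lambda_ge0 (phi:=phi))// => j;
    exact: phi_le.
(* Adding $N$ is monotone in the extended reals, so $N=+\infty$ needs no separate case. *)
apply: leeD2l; apply: le_nneseries_from => n n0.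
have stop0 y : 0 <= (under chi (stop_at psi (n:=n)) y)%:E.
  by rewrite lee_fin; exact: stop_at_ge0.
have w0 y : 0 <= under chi (min_weight fk lambda (n:=n)) y.
  exact: min_weight_ge0.
have mstop := measurable_under chi (measurable_stop_at psi n0).
apply/andP; split; first by apply: integral_ge0 => y _; exact: mule_ge0.
apply: ge0_le_integral => //.
- by move=> y _; exact: mule_ge0.
- apply: emeasurable_funM; first exact/measurable_EFinP.
  by apply: measurable_under; exact: measurable_min_weight.
- apply/measurable_EFinP; apply: measurable_funM => //.
  by apply: measurable_under; exact: measurable_decided_weight.
- move=> y _; rewrite [leRHS]EFinM; apply: lee_wpmul2l; first exact: stop0.
  exact: min_weight_le_decided.
Qed.
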